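(* Assume that the following conditions hold: (a) $a\in\mathbb{R}^{\ell}$, $F\subseteq\mathbb{R}^{\ell}$ is closed, and there exists some $u\in\mathbb{R}^{\ell}$ with $F\subseteq u+\mathbb{R}^{\ell}_+$. (b) $H$ is a proper closed subset of $\mathbb{R}^{\ell}$ with $\mathbb{R}^{\ell}_+\subseteq 0^+H$ and $k\in 0^+H\setminus\{0\}$ that, for each $j\in\{1,\ldots,\ell\}$, does not contain any line in the direction $e^j$. (c) The problem $(P_{F,a,H,k})$ has a feasible solution. (d) One of the following assumptions is fulfilled: (i) $F\cap(a-H)=\emptyset$, (ii) $F\cap(a-\operatorname{int}H)=\emptyset$ and $H+\mathbb{R}_{>}k\subset\operatorname{int}H$, (iii) $H$ does not contain a line in direction $k$, (iv) $H$ is convex and $k\notin-0^+H$. Then $M_{F,a,H,k}$ is nonempty and compact.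
   Context: $\ell\ge 1$ is an integer, $\mathbb{R}^{\ell}_+$ is the nonnegative orthant, $\mathbb{R}_>=(0,\infty)$, and $e^j$ is the $j$-th standard unit vector of $\mathbb{R}^{\ell}$. For $A\subseteq\mathbb{R}^{\ell}$, the recession cone is $0^+A:=\{u\in\mathbb{R}^{\ell}\mid A+\mathbb{R}_+u\subseteq A\}$, where $\mathbb{R}_+=[0,\infty)$. A proper subset of $\mathbb{R}^{\ell}$ is a nonempty subset different from $\mathbb{R}^{\ell}$. $\operatorname{int}$ is the topological interior. A set $H$ contains a line in direction $v$ if $x+\mathbb{R}v\subseteq H$ for some $x$. $(P_{F,a,H,k})$ is the problem of minimizing $t$ over all pairs $(y,t)\in F\times\mathbb{R}$ with $y\in a-H+tk$ (the feasible solutions). $M_{F,a,H,k}$ is the set of its optimal solutions $y$, i.e. of all $y\in F$ for which there is $t\in\mathbb{R}$ such that $(y,t)$ is feasible and $t\le s$ for every feasible $(z,s)$. *)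

(* Defs.v *)
From HB Require Import structures.
From mathcomp Require Import all_boot all_order all_algebra.
From mathcomp Require Import all_classical all_reals all_analysis.

Set Implicit Arguments.
Unset Strict Implicit.
Unset Printing Implicit Defensive.
Import Order.TTheory GRing.Theory Num.Theory.
Import numFieldNormedType.Exports.
Local Open Scope classical_set_scope.
Local Open Scope ring_scope.

(* R^l is the space of row vectors 'rV[R]_l, with its sup-norm topology. *)

Definition nonneg_orthant (R : realType) (l : nat) : set 'rV[R]_l :=
  [set x | forall j, 0 <= x 0 j].
Arguments nonneg_orthant : clear implicits.

Definition unit_vector (R : realType) (l : nat) (j : 'I_l) : 'rV[R]_l :=
  delta_mx 0 j.

(* 0^+ A = {u | A + R_+ u `<=` A}, for an arbitrary (not only convex) set A *)
Definition recession_cone (R : realType) (l : nat) (A : set 'rV[R]_l) :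
    set 'rV[R]_l :=
  [set u | [set x + s *: u | x in A & s in [set s : R | 0 <= s]] `<=` A].

Definition proper_subset (T : Type) (A : set T) : Prop :=
  A !=set0 /\ A <> setT.

Definition contains_line (R : realType) (l : nat) (A : set 'rV[R]_l)
    (v : 'rV[R]_l) : Prop :=
  exists x : 'rV[R]_l, [set x + s *: v | s in [set: R]] `<=` A.

Section ScalarizationProblem.
Variables (R : realType) (l : nat).
Variables (F : set 'rV[R]_l) (a : 'rV[R]_l) (H : set 'rV[R]_l) (k : 'rV[R]_l).

(* Feasible pairs (y, t) of: minimize t subject to y \in F, y \in a - H + t k *)
Definition feasible : set ('rV[R]_l * R) :=
  [set p | F p.1 /\ [set a - h + p.2 *: k | h in H] p.1].

Definition optimal_solutions : set 'rV[R]_l :=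
  [set y | F y /\ exists t : R, feasible (y, t) /\
    forall (z : 'rV[R]_l) (s : R), feasible (z, s) -> t <= s].

End ScalarizationProblem.

(* Main.v *)
Require Import Defs.
From HB Require Import structures.
From mathcomp Require Import all_boot all_order all_algebra.
From mathcomp Require Import all_classical all_reals all_analysis.
From mathcomp Require Import ring lra.

(** For fixed [t], the points [a - y + t k] of [H] with [y] in [F] lie below
    [b = a - u + t k].  If [y_j] were unbounded, then moving these points up
    inside [H], by the orthant inclusion, would give [b + R e^j] inside [H].
    Hence the sublevel sets are compact; they are nested, so some [y] lies in
    all the nonempty ones.  The attained values [t] are then exactly those with
    [a - y + t k] in [H], a closed set that contains [t + s] with [t] for
    [s >= 0].  Either it has a least element, the optimal value, or it is all
    of [R] and [a - y + R k] is a line in [H], which each of (i)-(iv)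
    excludes. *)

Set Implicit Arguments.
Unset Strict Implicit.
Unset Printing Implicit Defensive.
Import Order.TTheory GRing.Theory Num.Theory.
Import numFieldNormedType.Exports.
Local Open Scope classical_set_scope.
Local Open Scope ring_scope.

(** Being nested, the sets [B t] with [t] in [D] form a filter base. It clusters at some point of
    one compact member, and that point lies in every member since each is closed. *)
Lemma nested_compact_meet (R : realType) (T : topologicalType)
    (D : set R) (B : R -> set T) :
  D !=set0 -> {homo B : s t / s <= t >-> s `<=` t} ->
  (forall t, D t -> [/\ closed (B t), compact (B t) & B t !=set0]) ->
  \bigcap_(t in D) B t !=set0.
Proof.
move=> [t0 Dt0] Bmono HB.
have FF : Filter (filter_from D B).
  apply: filter_from_filter; first by exists t0.
  move=> s t Ds Dt; have [st|/ltW ts] := leP s t.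
    by exists s => // y By; split=> //; apply: Bmono By.
  by exists t => // y By; split=> //; apply: Bmono By.
have PF : ProperFilter (filter_from D B).
  by apply: filter_from_proper => t /HB[].
have [_ Bt0_compact _] := HB _ Dt0.
have [|y [_ y_cluster]] := Bt0_compact _ PF; first by exists t0.
exists y => t Dt; have [Bt_closed _ _] := HB _ Dt; apply: Bt_closed => U Uy.
by apply: y_cluster Uy; exists t.
Qed.

(** Let [e] tend to 0 from the right. The bound [e <= 1] allows [e] to be a convex weight. *)
Lemma closed_ray_start (R : realType) (V : normedModType R) (A : set V)
    (p v : V) :
  closed A -> (forall e : R, 0 < e -> e <= 1 -> A (p + e *: v)) -> A p.
Proof.
move=> A_closed Ae.
have e0 : e @[e --> (0 : R)^'+] --> (0 : R).
  exact/cvg_at_right_filter/cvg_id.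
have : (p + e *: v) @[e --> (0 : R)^'+] --> p + 0 *: v.
  by apply: cvgD; [exact: cvg_cst|exact: cvgZr_tmp].
rewrite scale0r addr0; apply: closed_cvg => //.
near=> e; apply: Ae; first by near: e; exact: nbhs_right_gt.
by near: e; apply: nbhs_right_ltW.
Unshelve. all: by end_near.
Qed.

Lemma subl_addr_continuous (R : realType) (V : normedModType R) (a b : V) :
  continuous (fun y : V => a - y + b).
Proof.
by move=> y; apply: cvgD; [apply: cvgB; [|exact: cvg_id]|]; exact: cvg_cst.
Qed.

Lemma recession_coneP (R : realType) (l : nat) (A : set 'rV[R]_l)
    (u : 'rV[R]_l) :
  recession_cone A u <-> forall x s, A x -> 0 <= s -> A (x + s *: u).
Proof.
split=> [Au x s Ax s0|Au _ [x Ax] [s s0 <-]]; last exact: Au.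
by apply: Au; exists x => //; exists s.
Qed.

Lemma upward_closed (R : realType) (l : nat) (A : set 'rV[R]_l)
    (x y : 'rV[R]_l) :
  nonneg_orthant R l `<=` recession_cone A ->
  A x -> (forall j, x 0 j <= y 0 j) -> A y.
Proof.
move=> A_orthant Ax xy.
have /A_orthant/recession_coneP/(_ x 1 Ax ler01) : nonneg_orthant R l (y - x).
  by move=> j; rewrite !mxE subr_ge0.
by rewrite scale1r addrCA subrr addr0.
Qed.

(** Mixing the far point [x0 + (s / e) *: v] of the line, with weight [e], and [x] gives
    [x + s *: v + e *: (x0 - x)], which tends to [x + s *: v] as [e] tends to 0. *)
Lemma convex_line_recession (R : realType) (l : nat) (A : set 'rV[R]_l)
    (v : 'rV[R]_l) :
  closed A -> convex_set A -> contains_line A v -> recession_cone A v.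
Proof.
move=> A_closed A_convex [x0 x0_line]; apply/recession_coneP => x s Ax s0.
apply: (@closed_ray_start _ _ _ _ (x0 - x)) => // e e_gt0 e_le1.
have Ay : A (x0 + (s / e) *: v) by apply: x0_line; exists (s / e).
have /set_mem := A_convex _ _ (Itv01 (ltW e_gt0) e_le1)
  (mem_set Ay) (mem_set Ax).
congr A; rewrite /conv/= /unstable.onem; apply/rowP => i; rewrite !mxE.
by field; exact: lt0r_neq0.
Qed.

Section Scalarization.
Variables (R : realType) (l : nat).
Variables (F : set 'rV[R]_l) (a : 'rV[R]_l) (H : set 'rV[R]_l) (k : 'rV[R]_l).

Definition sublevel (t : R) : set 'rV[R]_l :=
  [set y | F y /\ H (a - y + t *: k)].

Lemma feasibleE (y : 'rV[R]_l) (t : R) :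
  feasible F a H k (y, t) <-> sublevel t y.
Proof.
split=> [[Fy [h Hh /= hy]]|[Fy Hy]]; split=> //.
  suff <- : h = a - y + t *: k by [].
  by rewrite -hy; apply/rowP => i; rewrite !mxE; ring.
exists (a - y + t *: k) => //.
by apply/rowP => i; rewrite !mxE; ring.
Qed.

Hypothesis F_closed : closed F.
Hypothesis H_closed : closed H.

Lemma sublevel_closed (t : R) : closed (sublevel t).
Proof.
apply: closedI => //.
apply: (@preimage_closed _ _ (fun y : 'rV[R]_l => a - y + t *: k)) => // y _.
exact: subl_addr_continuous.
Qed.

Lemma sublevel_compact (u : 'rV[R]_l) (t : R) :
  F `<=` [set u + x | x in nonneg_orthant R l] ->
  nonneg_orthant R l `<=` recession_cone H ->
  (forall j, ~ contains_line H (unit_vector R j)) ->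
  compact (sublevel t).
Proof.
move=> F_lb H_orthant H_no_line.
pose b := a - u + t *: k.
have F_ge y j : F y -> u 0 j <= y 0 j.
  by move=> /F_lb[x x0 <-]; rewrite mxE lerDl; exact: x0.
(* The line through [b] in direction [e^j] leaves [H] at some parameter [M j], which bounds
   [y 0 j - u 0 j]. A negative [M j] is harmless: the box is then empty. *)
have /choice[M HM] j : exists s : R, ~ H (b - s *: unit_vector R j).
  apply/existsNP => Hb; apply: (H_no_line j); exists b => _ [s _ <-].
  by rewrite -[s]opprK scaleNr; exact: Hb.
apply: (@subclosed_compact _ _ [set v : 'rV[R]_l |
  forall j, `[u 0 j, u 0 j + M j]%classic (v ord0 j)]).
- exact: sublevel_closed.
- by apply: (@rV_compact R l (fun j => `[u 0 j, u 0 j + M j]%classic)) => j;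
    exact: segment_compact.
move=> y [Fy Hy] j; rewrite /= in_itv/= (F_ge _ _ Fy)/= leNgt.
(* Here [a - y + t *: k] is below [b - M j *: unit_vector R j]: in coordinate [j] by [y_gt], in the
   others because [u <= y]. *)
apply/negP => y_gt; apply: (HM j); apply: upward_closed Hy _ => // i.
rewrite !mxE eqxx/=; have := F_ge y i Fy.
by case: eqVneq => [->|_] /=; rewrite ?mulr1 ?mulr0; lra.
Qed.

Lemma sublevel_mono :
  recession_cone H k -> {homo sublevel : s t / s <= t >-> s `<=` t}.
Proof.
move=> /recession_coneP Hk s t st y [Fy Hy]; split=> //.
have := Hk _ (t - s) Hy; rewrite subr_ge0 => /(_ st).
by rewrite -addrA -scalerDl [s + _]addrC subrK.
Qed.

Lemma optimal_or_line :
  recession_cone H k -> (forall t, compact (sublevel t)) ->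
  feasible F a H k !=set0 ->
  (exists2 t, sublevel t !=set0 & optimal_solutions F a H k = sublevel t) \/
  exists2 y, F y & forall t, H (a - y + t *: k).
Proof.
move=> Hk sub_compact [[y0 t0] /feasibleE y0_feasible].
pose D := [set t | sublevel t !=set0].
have D0 : D !=set0 by exists t0, y0.
have [|y Dy] := nested_compact_meet D0 (sublevel_mono Hk).
  by move=> t Dt; split=> //; exact: sublevel_closed.
have Fy : F y by case: (Dy t0) => //; exists y0.
have D_mem t s : D t -> t <= s -> sublevel s y.
  by move=> Dt ts; apply: (sublevel_mono Hk ts); exact: Dy.
have [D_lb|/has_lbPn D_unb] := pselect (has_lbound D); [left|right]; last first.
  exists y => // t; have [s Ds /ltW st] := D_unb t.
  by case: (D_mem _ _ Ds st).
(* The infimum is attained at [y]: every level [inf D + e] with [e > 0] lies above a member of [D],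
   and [H] is closed. *)
have y_inf : sublevel (inf D) y.
  split=> //; apply: (@closed_ray_start _ _ _ _ k) => // e e0 _.
  have [|s Ds /ltW st] := @inf_lt _ D (inf D + e) D0; first by rewrite ltrDl.
  by have [_] := D_mem _ _ Ds st; rewrite scalerDl addrA.
exists (inf D); first by exists y.
have inf_min z s : feasible F a H k (z, s) -> inf D <= s.
  by move=> /feasibleE z_s; apply: ge_inf => //; exists z.
apply/seteqP; split=> z.
  move=> [_ [t [/feasibleE z_t t_min]]].
  (* Since [y] is feasible at [inf D], minimality of [t] gives [t <= inf D]. *)
  by apply: sublevel_mono z_t => //; apply: (t_min y); exact/feasibleE.
move=> z_inf; split; first by case: z_inf.
by exists (inf D); split=> //; exact/feasibleE.
Qed.

End Scalarization.

Theorem proposition7 (R : realType) (l : nat) (hl : (1 <= l)%N)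
    (F : set 'rV[R]_l) (a : 'rV[R]_l) (H : set 'rV[R]_l) (k : 'rV[R]_l)
    (F_closed : closed F)
    (F_bounded_below : exists u : 'rV[R]_l,
      F `<=` [set u + x | x in nonneg_orthant R l])
    (H_proper : proper_subset H)
    (H_closed : closed H)
    (H_orthant : nonneg_orthant R l `<=` recession_cone H)
    (k_recession : (recession_cone H `\ 0) k)
    (H_no_line : forall j : 'I_l, ~ contains_line H (unit_vector R j))
    (has_feasible : feasible F a H k !=set0)
    (hd : [\/ F `&` [set a - h | h in H] = set0,
              F `&` [set a - h | h in H°] = set0 /\
              [set h + s *: k | h in H & s in [set s : R | 0 < s]] `<=` H°,
              ~ contains_line H k |
              convex_set H /\ ~ [set - u | u in recession_cone H] k]) :
  optimal_solutions F a H k !=set0 /\ compact (optimal_solutions F a H k).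
Proof.
have [u F_lb] := F_bounded_below; have [Hk _] := k_recession.
have sub_compact t : compact (sublevel F a H k t).
  exact: (sublevel_compact F_closed H_closed F_lb).
have [[t t_ne ->]|[y Fy y_line]] :=
  optimal_or_line F_closed H_closed Hk sub_compact has_feasible; first by [].
exfalso; case: hd => [H0|[H0 H_int]|no_line|[H_convex Nk]].
- suff : set0 y by [].
  rewrite -H0; split=> //; exists (a - y); last by rewrite subKr.
  by have := y_line 0; rewrite scale0r addr0.
- suff : set0 y by [].
  rewrite -H0; split=> //; exists (a - y); last by rewrite subKr.
  (* Stepping back by [k] stays on the line, so [a - y] is a point of [H] plus [k], hence
     interior. *)
  apply: H_int; exists (a - y + (-1) *: k) => //; exists 1; first exact: ltr01.
  by rewrite -addrA -scalerDl addNr scale0r addr0.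
- by apply: no_line; exists (a - y) => _ [t _ <-].
(* The same line has direction [- k], so convexity makes [- k] a recession direction. *)
- apply: Nk; exists (- k); last by rewrite opprK.
  apply: convex_line_recession => //; exists (a - y) => _ [t _ <-].
  by rewrite scalerN -scaleNr.
Qed.
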